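(* Let $\tilde\chi>0$ and $\rho_n=\tilde\chi\ln n$. Let $u>0$ be the solution of $u(e^u-1)=1/\tilde\chi$ and put $$\tilde v=u-1+\frac1u+\ln\frac{e^u-1}{u}.$$ Then for any $\tilde s>e^{\tilde v}$, $$\lim_{n\to\infty}P\left(\left|\frac{b_1^{(n,\rho_n)}}{\rho_n}-1\right|\ge\tilde s\right)=0,$$ and for any $\tilde t>e^{\tilde v+1}$, $$P\left(\limsup_{n\to\infty}\left\{\omega:\ \left|\frac{b_1^{(n,\rho_n)}}{\rho_n}-1\right|\ge\tilde t\right\}\right)=0.$$
   Context: For each (sufficiently large) $n$ with $0<\rho_n<n$, $\{a_{ij}^{(n,\rho_n)}\}_{1\le i<j\le n}$ are jointly independent Bernoulli random variables equal to $1$ with probability $\rho_n/n$ and to $0$ with probability $1-\rho_n/n$; they are extended by symmetry $a_{ji}=a_{ij}$ and $a_{ii}=0$, giving the adjacency matrix of the Erdős–Rényi random graph. All these variables, for all $n$, form a triangular array defined on one probability space. The degree of vertex $i$ is $b_i^{(n,\rho_n)}=\sum_{l=1}^n a_{il}^{(n,\rho_n)}$, so $b_1^{(n,\rho_n)}$ is binomial with parameters $(n-1,\rho_n/n)$. The limsup of a sequence of events is the event that infinitely many of them occur. *)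

(* Defs.v *)
From HB Require Import structures.
From mathcomp Require Import all_boot all_order all_algebra finmap.
From mathcomp Require Import all_classical all_reals all_analysis.

Set Implicit Arguments.
Unset Strict Implicit.
Unset Printing Implicit Defensive.

Import Order.TTheory GRing.Theory Num.Theory.
Import numFieldNormedType.Exports.

Local Open Scope classical_set_scope.
Local Open Scope ring_scope.

Definition mutually_independent (d : measure_display) (T : measurableType d)
    (R : realType) (P : probability T R) (I : choiceType) (A : set I)
    (X : I -> {RV P >-> R}) : Prop :=
  forall J : {fset I}, [set` J] `<=` A ->
  forall B : I -> set R, (forall i, i \in J -> measurable (B i)) ->
    P (\bigcap_(i in [set` J]) (X i @^-1` B i)) =
    (\prod_(i <- J) P (X i @^-1` B i))%E.

Definition bernoulli_variable (d : measure_display) (T : measurableType d)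
    (R : realType) (P : probability T R) (p : R) (X : {RV P >-> R}) : Prop :=
  P (X @^-1` [set 1]) = p%:E /\ P (X @^-1` [set 0]) = (1 - p)%:E.

(* Vertices are 1, ..., n; the family x is meaningful only at pairs (i, j) with
   1 <= i < j <= n, its other entries are never used. *)
Definition upper_pairs (n : nat) : set (nat * nat) :=
  [set ij | (1 <= ij.1)%N /\ (ij.1 < ij.2)%N /\ (ij.2 <= n)%N].

Definition independent_edges (d : measure_display) (T : measurableType d)
    (R : realType) (P : probability T R) (n : nat) (p : R)
    (x : nat -> nat -> {RV P >-> R}) : Prop :=
  (forall ij, upper_pairs n ij -> bernoulli_variable p (x ij.1 ij.2)) /\
  mutually_independent (upper_pairs n) (fun ij => x ij.1 ij.2).

Definition adjacency (d : measure_display) (T : measurableType d)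
    (R : realType) (P : probability T R) (x : nat -> nat -> {RV P >-> R})
    (i j : nat) (w : T) : R :=
  if (i < j)%N then x i j w else if (j < i)%N then x j i w else 0.

Definition degree (d : measure_display) (T : measurableType d)
    (R : realType) (P : probability T R) (n : nat)
    (x : nat -> nat -> {RV P >-> R}) (i : nat) (w : T) : R :=
  \sum_(1 <= l < n.+1) adjacency x i l w.

(* Main.v *)
Require Import Defs.
From HB Require Import structures.
From mathcomp Require Import all_boot all_order all_algebra finmap.
From mathcomp Require Import all_classical all_reals all_analysis.
From mathcomp Require Import zify ring lra.

Set Implicit Arguments.
Unset Strict Implicit.
Unset Printing Implicit Defensive.

Import Order.TTheory GRing.Theory Num.Theory.
Import numFieldNormedType.Exports.

Local Open Scope classical_set_scope.
Local Open Scope ring_scope.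

(** The Chernoff bound at the parameter [u] itself gives
    [P (b_1 >= (1 + s) rho_n) <= n ^ (- k)] with
    [k = chi * (u * (1 + s) - (e^u - 1))], and [u (e^u - 1) = 1 / chi] turns
    [e^v < s] into [0 < k] and [e^(v + 1) < s] into [2 < k].  Hence the
    probabilities tend to 0 in the first case and are dominated by [1 / n ^ 2]
    in the second, where Borel-Cantelli applies.  Lower deviations do not occur
    because [1 < e^v] and degrees are nonnegative. *)

(** * Exponential tail bound for sums of independent Bernoulli variables *)

Lemma measure_bigsetU_le (d : measure_display) (T : measurableType d)
    (R : realType) (mu : {measure set T -> \bar R}) (I : Type) (s : seq I)
    (Q : pred I) (F : I -> set T) :
  (forall i, Q i -> measurable (F i)) ->
  (mu (\big[setU/set0]_(i <- s | Q i) F i) <= \sum_(i <- s | Q i) mu (F i))%E.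
Proof.
move=> mF.
suff [] : measurable (\big[setU/set0]_(i <- s | Q i) F i) /\
  (mu (\big[setU/set0]_(i <- s | Q i) F i) <= \sum_(i <- s | Q i) mu (F i))%E.
  by [].
elim/big_rec2: _ => [|i x A Qi [mA le_A]]; first by rewrite measure0.
split; first exact: measurableU (mF i Qi) mA.
apply: (le_trans (measureU2 mu (mF i Qi) mA)).
by rewrite leeD2l.
Qed.

(** The masses at 0 and 1 add up to one. The variables are real-valued, so other values remain
    possible on a null event, which the tail bound has to discard. *)
Lemma bernoulli_variable_ae01 (d : measure_display) (T : measurableType d)
    (R : realType) (P : probability T R) (p : R) (X : {RV P >-> R}) :
  bernoulli_variable p X -> P (X @^-1` ~` [set 0; 1]) = 0%E.
Proof.
move=> [X1 X0].
have m1 r : measurable (X @^-1` [set r]).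
  by rewrite -[X in measurable X]setTI; exact: measurable_funP.
rewrite -preimage_setC probability_setC; last first.
  by rewrite preimage_setU; exact: measurableU.
rewrite preimage_setU measureU//.
  by rewrite [X in (_ - (X + _))%E]X0 [X in (_ - (_ + X))%E]X1 -EFinD subrK subrr.
by apply/seteqP; split => // w /= [-> /eqP]; rewrite eq_sym oner_eq0.
Qed.

Section bernoulli_sum.
Context (d : measure_display) (T : measurableType d) (R : realType).
Context (P : probability T R) (I : choiceType) (J : {fset I}).
Context (X : I -> {RV P >-> R}) (p : R).
Hypotheses (p0 : 0 <= p) (p1 : p <= 1).
Hypothesis indepX : mutually_independent [set` J] X.
Hypothesis bernX : forall i, i \in J -> bernoulli_variable p (X i).

(** [insub] extends [f] from the finite type [J] to all of [I], as mutual independence expects; the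
    value outside [J] is a dummy. *)
Let pattern (f : {ffun J -> bool}) (i : I) : set R :=
  [set (if insub i is Some j then f j else false)%:R].

Let measurable_pattern (f : {ffun J -> bool}) (i : I) :
  measurable (X i @^-1` pattern f i).
Proof.
rewrite -[X in measurable X]setTI; apply: measurable_funP => //.
exact: measurable_set1.
Qed.

Lemma probability_pattern (f : {ffun J -> bool}) :
  P (\bigcap_(i in [set` J]) (X i @^-1` pattern f i)) =
  (\prod_(j : J) (if f j then p else 1 - p))%:E.
Proof.
rewrite indepX//; last by move=> i _; exact: measurable_set1.
rewrite big_seq_fsetE/=.
rewrite (@big_morph _ _ EFin 1%E *%E 1 *%R)//.
apply: eq_bigr => j _.
rewrite /pattern valK; have [X1 X0] := bernX (fsvalP j).
by case: (f j).
Qed.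

(* Every 0-1 pattern is charged its exact product weight, and
   [1 <= expR (u * (k - c))] on patterns with [k >= c] ones; summing over all
   patterns factorizes into the moment generating function. *)
Lemma chernoff_bernoulli_sum (u c : R) (A : set T) :
  0 <= u -> measurable A ->
  (forall w, A w -> (forall i, i \in J -> X i w = 0 \/ X i w = 1) ->
     c <= \sum_(i <- J) X i w) ->
  (P A <= (expR (#|` J|%:R * p * (expR u - 1) - u * c))%:E)%E.
Proof.
move=> u0 mA Ac.
(* [N] is the null event that some variable leaves {0, 1}; off [N], each point of [A] realizes a
   heavy pattern, hence lies in [U]. *)
pose N := \big[setU/set0]_(i <- J | i \in J) (X i @^-1` ~` [set 0; 1]).
pose heavy (f : {ffun J -> bool}) := c <= \sum_(j : J) (f j)%:R.
pose E (f : {ffun J -> bool}) := \bigcap_(i in [set` J]) (X i @^-1` pattern f i).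
pose U := \big[setU/set0]_(f | heavy f) E f.
have mC i : measurable (X i @^-1` ~` [set 0; 1]).
  rewrite -[X in measurable X]setTI; apply: measurable_funP => //.
  by apply: measurableC; apply: measurableU; exact: measurable_set1.
have mE f : measurable (E f) by apply: fin_bigcap_measurable => // i _.
have mN : measurable N by apply: bigsetU_measurable.
have mU : measurable U by apply: bigsetU_measurable.
have PN : P N = 0%E.
  apply/eqP; rewrite eq_le measure_ge0 andbT.
  apply: (le_trans (measure_bigsetU_le _ _ _)) => //.
  by rewrite big1// => i iJ; exact: bernoulli_variable_ae01 (bernX iJ).
have AUN : A `<=` U `|` N.
  move=> w Aw; have [w01|] := pselect (forall i, i \in J -> X i w = 0 \/ X i w = 1).
    left; have := Ac w Aw w01.
    pose f : {ffun J -> bool} := [ffun j => X (val j) w == 1].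
    have fE (j : J) : X (val j) w = (f j)%:R.
      rewrite ffunE; have [->|->] := w01 _ (fsvalP j); last by rewrite eqxx.
      by rewrite eq_sym oner_eq0.
    rewrite big_seq_fsetE/= => cf.
    rewrite /U (bigD1 f)/=; last by rewrite /heavy -(eq_bigr _ (fun j _ => fE j)).
    left => i /= iJ; rewrite /pattern.
    by rewrite /= (insubT (fun i => i \in J) iJ) -fE.
  move=> /existsNP[i /not_implyP[iJ Xi]]; right.
  by rewrite /N -bigcup_seq_cond/=; exists i => //=; rewrite iJ.
apply: (@le_trans _ _ (P U)).
  by rewrite -(measureU0 mU mN PN) le_measure ?inE//; exact: measurableU.
apply: (le_trans (measure_bigsetU_le _ _ _)) => //.
rewrite (eq_bigr _ (fun f _ => probability_pattern f)) sumEFin lee_fin.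
pose wt (b : bool) := expR (u * b%:R) * (if b then p else 1 - p).
have wt0 b : 0 <= wt b.
  by rewrite mulr_ge0 ?expR_ge0//; case: b => //; rewrite subr_ge0.
apply: (@le_trans _ _ (expR (- (u * c)) * \sum_(f : {ffun J -> bool}) \prod_(j : J) wt (f j))).
  rewrite mulr_sumr [leRHS](bigID heavy)/= -[leLHS]addr0 lerD//; last first.
    by apply: sumr_ge0 => f _; rewrite mulr_ge0 ?expR_ge0// prodr_ge0.
  apply: ler_sum => f hf; rewrite big_split/= mulrA ler_peMl//.
    by apply: prodr_ge0 => j _; case: (f j) => //; rewrite subr_ge0.
  rewrite -expR_sum -expRD -[leLHS]expR0 ler_expR -mulr_sumr -mulrN -mulrDr.
  by rewrite mulr_ge0// addrC subr_ge0.
rewrite -(bigA_distr_bigA (fun _ b => wt b))/=.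
rewrite (eq_bigr (fun=> 1 + p * (expR u - 1))); last first.
  by move=> j _; rewrite big_bool/= /wt mulr1 mulr0 expR0; ring.
(* The generating function is now a power of 1 + p (e^u - 1), and 1 + x <= e^x bounds each
   factor. *)
rewrite prodr_const -cardfE expRD [leRHS]mulrC ler_wpM2l ?expR_ge0//.
rewrite -mulrA expRM_natl lerXn2r ?nnegrE ?expR_ge0//.
  by rewrite addr_ge0// mulr_ge0// subr_ge0 -expR0 ler_expR.
exact: expR_ge1Dx.
Qed.

End bernoulli_sum.

(** * The degree of vertex 1 as a Bernoulli sum over its incident edges *)

Definition star_pairs (n : nat) : {fset nat * nat} :=
  seq_fset tt [seq (1%N, l) | l <- index_iota 2 n.+1].

Lemma perm_star_pairs (n : nat) :
  perm_eq (star_pairs n) [seq (1%N, l) | l <- index_iota 2 n.+1].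
Proof.
rewrite (perm_trans (seq_fset_perm _ _))// undup_id//.
by rewrite map_inj_uniq ?iota_uniq// => i j [].
Qed.

Lemma star_pairs_sub (n : nat) : [set` star_pairs n] `<=` upper_pairs n.
Proof.
move=> ij /=; rewrite (perm_mem (perm_star_pairs n)) => /mapP[l].
by rewrite mem_index_iota ltnS => /andP[l2 ln] ->.
Qed.

Section degree.
Context (d : measure_display) (T : measurableType d) (R : realType).
Context (P : probability T R) (n : nat) (x : nat -> nat -> {RV P >-> R}).

Lemma degree1E (w : T) :
  degree n x 1 w = \sum_(ij <- star_pairs n) x ij.1 ij.2 w.
Proof.
rewrite (perm_big _ (perm_star_pairs n)) big_map /degree.
have [->|n0] := posnP n; first by rewrite !big_geq.
rewrite [LHS]big_ltn// {1}/adjacency ltnn add0r.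
by apply: eq_big_nat => l /andP[l1 _]; rewrite /adjacency l1.
Qed.

Lemma measurable_degree (i : nat) : measurable_fun setT (degree n x i).
Proof.
apply: measurable_sum => l; rewrite /adjacency.
case: (i < l)%N; first exact: measurable_funP.
by case: (l < i)%N; [exact: measurable_funP|exact: measurable_cst].
Qed.

Lemma measurable_degree_deviation (i : nat) (r t : R) :
  measurable [set w | t <= `|degree n x i w / r - 1|].
Proof.
pose f w := `|degree n x i w / r - 1|.
have mf : measurable_fun setT f.
  apply: measurableT_comp => //; apply: measurable_realfun.measurable_funB => //.
  by apply: measurable_realfun.measurable_funM => //; exact: measurable_degree.
have -> : [set w | t <= f w] = setT `&` f @^-1` `[t, +oo[.
  by apply/seteqP; split=> w /=; rewrite in_itv/= andbT => // -[].
exact: mf.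
Qed.

(* For [1 < t] the lower deviation is void, since degrees are almost surely
   nonnegative. *)
Lemma degree1_deviation_le (r t u : R) :
  independent_edges n (r / n%:R) x -> 0 < r -> r < n%:R -> 0 <= u -> 1 < t ->
  (P [set w | (t <= `|degree n x 1 w / r - 1|)%R] <=
   (expR (r * (expR u - 1) - u * ((1 + t) * r)))%:E)%E.
Proof.
move=> [bern indep] r0 rn u0 t1.
have n0 : 0 < n%:R :> R by exact: lt_trans rn.
have p0 : 0 <= r / n%:R by rewrite divr_ge0// ltW.
have p1 : r / n%:R <= 1 by rewrite ler_pdivrMr// mul1r ltW.
apply: (@le_trans _ _ (expR (#|` star_pairs n|%:R * (r / n%:R) * (expR u - 1)
    - u * ((1 + t) * r)))%:E).
  apply: (@chernoff_bernoulli_sum _ _ _ _ _ _ (fun ij => x ij.1 ij.2)) => //.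
  - by move=> J sJ; apply: indep; apply: subset_trans sJ (@star_pairs_sub n).
  - by move=> ij ijJ; apply: bern; exact: star_pairs_sub.
  - exact: measurable_degree_deviation.
  - move=> w /= tw w01; rewrite -degree1E.
    have b0 : 0 <= degree n x 1 w / r.
      rewrite divr_ge0 ?(ltW r0)// degree1E big_seq sumr_ge0// => ij /w01.
      by case=> ->.
    rewrite -ler_pdivlMr//.
    move: tw; rewrite ler_normr => /orP[|]; lra.
rewrite lee_fin ler_expR lerD2r ler_wpM2r//.
  by rewrite subr_ge0 -[leLHS]expR0 ler_expR.
(* Vertex 1 has n - 1 potential edges, so the mean (n - 1) r / n is at most r. *)
rewrite mulrCA ler_piMr ?(ltW r0)// ler_pdivrMr// mul1r ler_nat.
rewrite (perm_size (perm_star_pairs n)) size_map size_iota.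
by rewrite subSS leq_subr.
Qed.

End degree.

(** * From tail bounds to limits *)

Lemma inv_square_le_telescope (R : realFieldType) (m : R) : 1 <= m ->
  m ^- 2 <= 2 / m - 2 / (m + 1).
Proof.
move=> m1; rewrite -subr_ge0.
have -> : 2 / m - 2 / (m + 1) - m ^- 2 = (m - 1) / (m ^+ 2 * (m + 1)).
  by field; apply/andP; split; lra.
by rewrite divr_ge0 ?mulr_ge0 ?exprn_ge0//; lra.
Qed.

Section probability_sequences.
Context (d : measure_display) (T : measurableType d) (R : realType).
Context (P : probability T R) (F : nat -> set T).
Hypothesis mF : forall n, measurable (F n).

(** Partial sums stay below M + 3: the first M + 1 terms are at most 1 each, and the later ones
    telescope through 1 / m^2 <= 2 / m - 2 / (m + 1). Starting at M + 1 keeps every denominator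
    positive. *)
Lemma borel_cantelli_inv_square (M : nat) :
  (forall n, (M <= n)%N -> (P (F n) <= (n%:R ^- 2)%:E)%E) ->
  P (lim_sup_set F) = 0%E.
Proof.
move=> PF; apply: lim_sup_set_cvg0 => //.
have F1 n : (P (F n) <= 1%:E)%E by exact: probability_le1.
have start n : (\sum_(0 <= k < n) P (F k) <= n%:R%:E)%E.
  elim: n => [|n IHn]; first by rewrite big_geq.
  by rewrite big_nat_recr//= -natr1 EFinD leeD.
have tail j : (\sum_(0 <= k < M.+1 + j) P (F k) <=
    (M.+1%:R + 2 - 2 / (M.+1 + j)%:R)%:E)%E.
  elim: j => [|j IHj].
    rewrite addn0; apply: le_trans (start _) _; rewrite lee_fin.
    rewrite -addrA lerDl subr_ge0 ler_pdivrMr ?ltr0n//.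
    by rewrite ler_peMr// ler1n.
  rewrite addnS big_nat_recr//=.
  apply: (le_trans (leeD IHj (PF _ _))); first by lia.
  rewrite -EFinD lee_fin.
  have m1 : 1 <= (M.+1 + j)%:R :> R by rewrite ler1n addSn.
  rewrite -[(M.+1 + j).+1%:R]natr1.
  by rewrite -addrA lerD2l -lerBrDl opprK addrC inv_square_le_telescope.
apply: (@le_lt_trans _ _ (M.+1%:R + 2)%:E); last exact: ltry.
apply: lime_le; first by apply: is_cvg_nneseries => n _ _; exact: measure_ge0.
near=> n.
have Mn : (M.+1 <= n)%N by near: n; exact: nbhs_infty_ge.
rewrite -(subnKC Mn); apply: le_trans (tail _) _.
by rewrite lee_fin gerBl divr_ge0.
Unshelve. all: by end_near.
Qed.

Lemma probability_cvg0_power (k : R) (M : nat) : 0 < k ->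
  (forall n, (M <= n)%N -> (P (F n) <= (expR (- (k * ln n%:R)))%:E)%E) ->
  P (F n) @[n --> \oo] --> (0 : \bar R).
Proof.
move=> k0 PF.
apply/fine_cvgP; split; first by near=> n; exact: fin_num_measure.
apply/cvgr0Pnorm_le => e e0; near=> n.
have := PF n; rewrite -(fineK (fin_num_measure P (F n) (mF n))) lee_fin.
rewrite /= ger0_norm ?fine_ge0// => H; apply: (le_trans (H _)).
  by near: n; exact: nbhs_infty_ge.
(* This threshold is the solution of n^(-k) = e. *)
have en : expR (- ln e / k) <= n%:R by near: n; exact: nbhs_infty_ger.
have n0 : 0 < n%:R :> R by apply: lt_le_trans en; exact: expR_gt0.
rewrite -[leRHS]lnK ?posrE// ler_expR lerNl mulrC -ler_pdivrMr//.
by rewrite -ler_expR lnK ?posrE.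
Unshelve. all: by end_near.
Qed.

End probability_sequences.

Lemma eventually_log_regime (R : realType) (chi : R) : 0 < chi ->
  \forall n \near \oo, 0 < chi * ln n%:R /\ chi * ln n%:R < n%:R.
Proof.
move=> chi0; near=> n.
(* With L = ln n >= 4 chi, one gets chi L <= L^2 / 4 < (1 + L / 2)^2 <= e^L = n. *)
have cn : expR (4 * chi) <= n%:R by near: n; exact: nbhs_infty_ger.
have n0 : 0 < n%:R :> R by apply: lt_le_trans cn; exact: expR_gt0.
have : 4 * chi <= ln n%:R by rewrite -ler_expR lnK ?posrE.
rewrite -[in X in _ -> _ /\ _ < X](lnK (x := n%:R)) ?posrE//.
move: (ln _) => L L4; split; first by rewrite mulr_gt0//; lra.
have -> : L = L / 2 + L / 2 by lra.
rewrite expRD; have := expR_ge1Dx (L / 2); nra.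
Unshelve. all: by end_near.
Qed.

(** * Inequalities for the constants u and v *)

Lemma ge2_addV (R : realFieldType) (u : R) : 0 < u -> 2 <= u + u^-1.
Proof.
move=> u0; rewrite -subr_ge0; have -> : u + u^-1 - 2 = (u - 1) ^+ 2 / u.
  by field; rewrite gt_eqF.
by rewrite divr_ge0 ?sqr_ge0 ?ltW.
Qed.

Lemma expR_subr1_ge (R : realType) (u : R) : u <= expR u - 1.
Proof. by rewrite lerBrDl expR_ge1Dx. Qed.

(** Multiply e^u >= (1 + u / 2)^2 by e^(1/u) >= 1 + 1/u. The product exceeds 1 + 2 u by (u - 3/2)^2
    / 4 + 7/16 + 1/u. *)
Lemma expR_addV_ge (R : realType) (u : R) : 0 < u ->
  1 + 2 * u <= expR (u + u^-1).
Proof.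
move=> u0; rewrite expRD.
have e2 : (1 + u / 2) ^+ 2 <= expR u.
  have -> : expR u = expR (u / 2) ^+ 2.
    by rewrite expr2 -expRD; congr expR; lra.
  by rewrite lerXn2r ?nnegrE ?expR_ge0 ?expR_ge1Dx//; lra.
have ui0 : 0 < u^-1 by rewrite invr_gt0.
apply: (@le_trans _ _ ((1 + u / 2) ^+ 2 * (1 + u^-1))).
  have -> : (1 + u / 2) ^+ 2 * (1 + u^-1) =
    2 + 5 / 4 * u + u ^+ 2 / 4 + u^-1 by field; rewrite gt_eqF.
  have := sqr_ge0 (u - 3 / 2); lra.
by rewrite ler_pM ?sqr_ge0 ?expR_ge1Dx//; lra.
Qed.

Definition rate (R : realType) (chi u s : R) :=
  chi * (u * (1 + s) - (expR u - 1)).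

(** Put e = e^u - 1, so that chi = 1 / (u e) and the goal reads k u e < u (1 + s) - e. This follows
    from u s > y e >= (1 + k u) e. Here [y] is the threshold for [s] stripped of the factor e / u
    contributed by the logarithm in v. *)
Lemma rate_gt (R : realType) (chi u k s y : R) :
  0 < u -> u * (expR u - 1) = 1 / chi ->
  y * ((expR u - 1) / u) < s -> 1 + k * u <= y -> k < rate chi u s.
Proof.
rewrite /rate => u0 ue; have := expR_subr1_ge u.
move: (expR u - 1) ue => e ue ue' ys ky.
have e0 : 0 < e by exact: lt_le_trans ue'.
have -> : chi = (u * e)^-1 by rewrite ue div1r invrK.
rewrite mulrC ltr_pdivlMr ?mulr_gt0//.
move: ys; rewrite mulrA ltr_pdivrMr// => ys.
have : (1 + k * u) * e <= y * e by rewrite ler_wpM2r// ltW.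
lra.
Qed.

Section constants.
Context (R : realType) (chi u v : R).
Hypotheses (u0 : 0 < u) (u_eq : u * (expR u - 1) = 1 / chi).
Hypothesis v_eq : v = u - 1 + 1 / u + ln ((expR u - 1) / u).

Let ratio_ge1 : 1 <= (expR u - 1) / u.
Proof. by rewrite ler_pdivlMr// mul1r expR_subr1_ge. Qed.

Let expR_v : expR v = expR (u - 1 + u^-1) * ((expR u - 1) / u).
Proof.
by rewrite v_eq expRD lnK ?posrE ?(lt_le_trans _ ratio_ge1)// div1r.
Qed.

Let exponent_ge : 2 <= expR (u - 1 + u^-1).
Proof. by apply: le_trans (expR_ge1Dx _); have := ge2_addV u0; lra. Qed.

Lemma rate_gt0 (s : R) : expR v < s -> 0 < rate chi u s.
Proof.
rewrite expR_v => vs; apply: (rate_gt u0 u_eq vs).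
by rewrite mul0r addr0; apply: le_trans exponent_ge; rewrite ler1n.
Qed.

Lemma expR_v_gt1 : 1 < expR v.
Proof.
rewrite expR_v; apply: (@lt_le_trans _ _ (2 * 1)); first by rewrite mulr1 ltr1n.
by rewrite ler_pM.
Qed.

(** The extra 1 cancels the -1 in v, leaving y = e^(u + 1/u) >= 1 + 2 u, which is the case k = 2 of
    [rate_gt]. *)
Lemma rate_gt2 (t : R) : expR (v + 1) < t -> 2 < rate chi u t.
Proof.
rewrite expRD expR_v mulrAC -expRD => vt; apply: (rate_gt u0 u_eq vt).
by rewrite (_ : _ + 1 = u + u^-1) ?expR_addV_ge//; ring.
Qed.

End constants.

Theorem theorem3p1 (R : realType) (d : measure_display) (T : measurableType d)
    (P : probability T R) (chi : R) (rho : nat -> R)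
    (a : nat -> nat -> nat -> {RV P >-> R}) (N0 : nat) (u v : R)
    (hchi : 0 < chi)
    (hrho : forall n : nat, (0 < n)%N -> rho n = chi * ln (n%:R : R))
    (ha : forall n : nat, (N0 <= n)%N -> 0 < rho n -> rho n < n%:R ->
       independent_edges n (rho n / n%:R) (a n))
    (hu : 0 < u)
    (hu_eq : u * (expR u - 1) = 1 / chi)
    (hv : v = u - 1 + 1 / u + ln ((expR u - 1) / u)) :
  (forall s : R, expR v < s ->
     (fun n : nat => P [set w | s <= `|degree n (a n) 1 w / rho n - 1|])
       @ \oo --> (0 : \bar R)) /\
  (forall t : R, expR (v + 1) < t ->
     P (lim_sup_set
          (fun n : nat => [set w | t <= `|degree n (a n) 1 w / rho n - 1|]))
     = (0 : \bar R)).
Proof.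
have [M0 _ regime] := eventually_log_regime hchi.
pose M := maxn (maxn N0 M0) 1.
have tail s : 1 < s -> forall n, (M <= n)%N ->
    (P [set w | (s <= `|degree n (a n) 1 w / rho n - 1|)%R] <=
     (expR (- (rate chi u s * ln n%:R)))%:E)%E.
  move=> s1 n; rewrite !geq_max => /andP[/andP[N0n M0n] n1].
  have [r0 rn] := regime n M0n; rewrite -hrho// in r0 rn.
  apply: (le_trans (degree1_deviation_le (ha n N0n r0 rn) r0 rn (ltW hu) s1)).
  (* Substituting rho_n = chi ln n turns the Chernoff exponent into exactly minus the rate times ln
     n. *)
  by rewrite lee_fin ler_expR hrho// /rate; lra.
have v1 := expR_v_gt1 hu hv.
split=> [s vs|t vt].
  have k0 := rate_gt0 hu hu_eq hv vs.
  apply: (probability_cvg0_power _ k0 (tail s (lt_trans v1 vs))) => n.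
  exact: measurable_degree_deviation.
have t1 : 1 < t.
  by apply: lt_trans vt; apply: lt_trans v1 _; rewrite ltr_expR ltrDl.
have k2 := rate_gt2 hu hu_eq hv vt.
apply: (@borel_cantelli_inv_square _ _ _ _ _ _ M) => n.
  exact: measurable_degree_deviation.
move=> Mn; apply: (le_trans (tail t t1 n Mn)); rewrite lee_fin.
have n1 : (0 < n)%N by move: Mn; rewrite geq_max => /andP[].
have -> : n%:R ^- 2 = expR (- (2 * ln n%:R)) :> R.
  by rewrite expRN mulr_natl mulr2n expRD lnK ?posrE ?ltr0n// expr2.
(* Since n >= 1, ln n is nonnegative and a rate above 2 gives decay at least as fast as n^(-2). *)
by rewrite ler_expR lerN2 ler_wpM2r ?ln_ge0 ?ler1n// ltW.
Qed.
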